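(* Let $(V,\mathcal{J})$ be a finite-dimensional real vector space with a linear generalized complex structure with classical tensors $(A,\pi,\sigma)$, and let $f_*:V\to W$ be a linear surjection; identify $W^*$ with $\mathrm{ann}(\ker f_* )\subseteq V^*$ via $f^*$. 1. The image $W$ of $f_*$ has the projected generalized complex structure $\tilde{\mathcal J}$ if and only if $$W^*\cap\flat_\sigma(\ker f_* )=0,\qquad A^*(W^* )\subseteq W^*+\mathrm{im}\,\flat_\sigma,$$ equivalently, if and only if $$V=\ker f_*+\mathrm{ann}(\flat_\sigma(\ker f_* )),\qquad A^*(W^* )\subseteq W^*\oplus\flat_\sigma(\ker f_* ).$$ 2. Let $B=V\oplus W^*\subseteq\mathbf{V}$. The existence of the projected structure is also characterized by each of the following equivalent conditions: (a* ) $B=B\cap(\mathcal{J}B)+\ker f_*$; (b* ) $\mathcal{J}B\subseteq B+\mathcal{J}(\ker f_* )$; (c* ) $(\mathcal{J}B)^{\perp_g}\cap B\subseteq\ker f_*$.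
   Context: For a finite-dimensional real vector space $V$ put $\mathbf{V}=V\oplus V^*$ with the neutral metric $g((X,\alpha),(Y,\mu))=\frac12(\alpha(Y)+\mu(X))$; the superscript $c$ denotes complexification. A linear generalized complex structure on $V$ is $\mathcal{J}\in\mathrm{End}(\mathbf V)$ with $\mathcal{J}^2=-\mathrm{Id}$ and $g(\mathcal{X},\mathcal{J}\mathcal{Y})+g(\mathcal{J}\mathcal{X},\mathcal{Y})=0$; it can be written $\mathcal{J}(X,\alpha)=(AX+\sharp_\pi\alpha,\flat_\sigma X-A^*\alpha)$ with $A\in\mathrm{End}(V)$, $\pi\in\wedge^2V$, $\sigma\in\wedge^2V^*$, $\sharp_\pi\alpha=i(\alpha)\pi$, $\flat_\sigma X=i(X)\sigma$, $A^*$ the transpose of $A$. It is equivalent to its $i$-eigenspace $L\subset\mathbf V^c$, a maximal $g$-isotropic subspace with $L\cap\bar L=0$. A subspace of $V$ (e.g. $\ker f_*$) is regarded as a subspace of $\mathbf V$ via $X\mapsto(X,0)$, and $\mathrm{ann}$ denotes annihilator. For a linear map $f_*:V\to W$ with transpose $f^*:W^*\to V^*$, the push-forward of a subspace $S$ of $\mathbf V$ (or $\mathbf V^c$) is $\overrightarrow f_*S=\{(f_*X,\eta):(X,f^*\eta)\in S,\ X\in V,\ \eta\in W^*\}$ (complexified where needed). The surjection $f_*:(V,\mathcal J)\to W$ has image with projected structure if $\overrightarrow f_*L\cap\overrightarrow f_*\bar L=0$; then $\overrightarrow f_*L$ is the $i$-eigenspace of a linear generalized complex structure $\tilde{\mathcal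 J}$ on $W$, the projected structure. *)

(* Defs.v *)
From HB Require Import structures.
From mathcomp Require Import all_boot all_order all_algebra.
From mathcomp Require Import sesquilinear reals complex.

Set Implicit Arguments.
Unset Strict Implicit.
Unset Printing Implicit Defensive.

Import Order.TTheory GRing.Theory Num.Theory VectorInternalTheory.

Local Open Scope ring_scope.
Local Open Scope complex_scope.

Notation dual V := 'Hom(V, _^o).

Definition dprod (R : realType) (V W : vectType R) : vectType R := (V * W)%type.

Notation big V := (dprod V (dual V)).

Lemma linfunE (F : fieldType) (U V : vectType F) (f : U -> V) :
  linear f -> linfun f =1 f.
Proof.
move=> flin; pose h : {linear U -> V} :=
  HB.pack f (GRing.isLinear.Build F U V _ f flin).
exact: (lfunE h).
Qed.

Lemma mem_bigcap_lker (F : fieldType) (U V W : vectType F) (h : U -> 'Hom(V, W))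
    (S : {vspace U}) x : linear h ->
  x \in (\bigcap_(i < \dim S) lker (h (vbasis S)`_i))%VS
  <-> (forall u, u \in S -> h u x = 0).
Proof.
move=> hlin; split=> [|xS].
  rewrite memvE => /subv_bigcapP xS u /coord_vbasis ->.
  rewrite -(linfunE hlin) linear_sum sum_lfunE big1 // => i _.
  rewrite linearZ /= scale_lfunE (linfunE hlin).
  have := xS i isT; rewrite -memvE memv_ker => /eqP ->; exact: scaler0.
rewrite memvE; apply/subv_bigcapP => i _; rewrite -memvE memv_ker.
by rewrite xS // vbasis_mem // mem_nth // size_tuple.
Qed.

Section Duality.
Variables (R : realType) (V W : vectType R).

Definition transpose (f : 'Hom(V, W)) : 'Hom(dual W, dual V) :=
  linfun (fun a : dual W => (a \o f)%VF : dual V).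

Lemma transposeE f a x : transpose f a x = a (f x).
Proof.
rewrite linfunE ?lfunE // => c b d.
by rewrite comp_lfunDl comp_lfunZl.
Qed.

(* The annihilator in V of a subspace S of V^*. *)
Definition coann (S : {vspace dual V}) : {vspace V} :=
  (\bigcap_(i < \dim S) lker (vbasis S)`_i)%VS.

Lemma mem_coann (S : {vspace dual V}) x :
  x \in coann S <-> (forall a : dual V, a \in S -> a x = 0).
Proof. exact: (@mem_bigcap_lker _ _ _ _ id). Qed.

Definition bidual : 'Hom(V, dual (dual V)) :=
  linfun (fun x : V => linfun (fun a : dual V => a x : R^o) : dual (dual V)).

Lemma bidualE x a : bidual x a = a x.
Proof.
have lin y : linear (fun a : dual V => a y : R^o).
  by move=> c b d; rewrite add_lfunE scale_lfunE.
rewrite linfunE ?linfunE // => c y z; apply/lfunP=> b.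
by rewrite add_lfunE scale_lfunE !linfunE // linearP.
Qed.

Lemma limg_bidual : limg bidual = fullv.
Proof.
have ker0 : (lker bidual = 0)%VS.
  apply/eqP; rewrite -subv0; apply/subvP => x; rewrite memv_ker => /eqP x0.
  have xV : x \in (fullv : {vspace V}) by exact: memvf.
  rewrite (coord_vbasis xV) big1 ?mem0v // => i _.
  pose a : dual V := linfun (coord (vbasis fullv) i : V -> R^o).
  have : bidual x a = 0 by rewrite x0 zero_lfunE.
  rewrite bidualE linfunE; last by move=> c y z; rewrite linearP.
  by move=> ->; rewrite scale0r.
apply/eqP; rewrite eqEdim subvf /= limg_dim_eq ?ker0 ?capv0 //.
rewrite !dimvf; have -> : dim (dual (dual V)) = (dim V * 1 * 1)%N by [].
by rewrite !muln1.
Qed.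

(* flat s X = i(X) s, with (i(X) s)(Y) = s X Y. *)
Definition flat (s : {skew_symmetric V}) : 'Hom(V, dual V) :=
  linfun (fun x : V => linfun (s x : V -> R^o) : dual V).

Lemma flatE s x y : flat s x y = s x y.
Proof.
have lin z : linear (s z : V -> R^o) by move=> c u v; exact: linearPr.
rewrite linfunE ?linfunE // => c u v; apply/lfunP=> z.
by rewrite add_lfunE scale_lfunE !linfunE // linearPl.
Qed.

End Duality.

(* A bivector on V is a skew-symmetric form p on V^*; sharp p a = i(a) p is    *)
(* the functional p a on V^*, seen as a vector through V = V^**.               *)
Definition sharp (R : realType) (V : vectType R) (p : {skew_symmetric dual V}) :
    'Hom(dual V, V) :=
  ((bidual V)^-1 \o flat p)%VF.

Lemma sharpE (R : realType) (V : vectType R) (p : {skew_symmetric dual V})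
  (a b : dual V) : b (sharp p a) = p a b.
Proof.
by rewrite -bidualE comp_lfunE limg_lfunVK ?flatE // limg_bidual memvf.
Qed.

Section GeneralizedComplex.
Variables (R : realType) (V : vectType R).

Definition metric (x y : big V) : R := 2^-1 * (x.2 y.1 + y.2 x.1).

Fact metric_sym x y : metric x y = (-1) ^+ false * idfun (metric y x).
Proof. by rewrite expr0 mul1r /metric addrC. Qed.

Fact metric_bilinear : bilinear_for
  (GRing.Scale.Law.clone _ _ *%R _) (GRing.Scale.Law.clone _ _ (idfun \; *%R) _)
  metric.
Proof.
have linl (u : big V) : GRing.linear_for *%R (metric^~ u).
  move=> c x y; rewrite /metric /= add_lfunE scale_lfunE linearP.
  rewrite /= -![_ *: _]/(c * _).
  by rewrite addrACA -(mulrDr c) (mulrDr 2^-1) mulrCA.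
split=> // u c x y; have := linl u c x y.
by rewrite !(metric_sym u) !expr0 !mul1r.
Qed.

HB.instance Definition _ := bilinear_isBilinear.Build R (big V) (big V) R
  _ _ metric metric_bilinear.
HB.instance Definition _ := isHermitianSesquilinear.Build R (big V) false idfun
  metric metric_sym.

Definition gen_complex (J : 'End(big V)) : Prop :=
  (J \o J)%VF = - \1%VF /\
  forall x y, metric x (J y) + metric (J x) y = 0.

Definition classical_tensors (J : 'End(big V)) (A : 'End(V))
    (p : {skew_symmetric dual V}) (s : {skew_symmetric V}) : Prop :=
  forall (X : V) (a : dual V),
    J (X, a) = (A X + sharp p a, flat s X - transpose A a).

Definition embV : 'Hom(V, big V) := linfun (fun x : V => (x, 0) : big V).
Definition embD : 'Hom(dual V, big V) := linfun (fun a : dual V => (0, a) : big V).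

Lemma embVE x : embV x = (x, 0).
Proof. by rewrite linfunE // => c y z; congr (_, _); rewrite /= scaler0 addr0. Qed.

Lemma embDE a : embD a = (0, a).
Proof. by rewrite linfunE // => c y z; congr (_, _); rewrite /= scaler0 addr0. Qed.

Definition dsum (U : {vspace V}) (S : {vspace dual V}) : {vspace big V} :=
  (embV @: U + embD @: S)%VS.

Lemma mem_dsum U S x : (x \in dsum U S) = (x.1 \in U) && (x.2 \in S).
Proof.
apply/memv_addP/andP => [[_ /memv_imgP[u uU ->] [_ /memv_imgP[a aS ->] ->]]|].
  by rewrite embVE embDE /= addr0 add0r.
case: x => u a /= [uU aS]; exists (embV u); first exact: memv_img.
exists (embD a); first exact: memv_img.
by rewrite embVE embDE; congr (_, _); rewrite /= ?addr0 ?add0r.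
Qed.

End GeneralizedComplex.

Arguments metric {R V}.
Arguments embV {R V}.
Arguments embD {R V}.

(* The complexification V (x) C: the pair (x, y) stands for x + i y. *)
Definition cplx (R : realType) (V : vectType R) : Type := (V * V)%type.

Section Complexification.
Variables (R : realType) (V : vectType R).

HB.instance Definition _ := GRing.Zmodule.on (cplx V).

Definition cplx_scale (c : R[i]) (z : cplx V) : cplx V :=
  (complex.Re c *: z.1 - complex.Im c *: z.2, complex.Re c *: z.2 + complex.Im c *: z.1).

Fact cplx_scaleA a b z :
  cplx_scale a (cplx_scale b z) = cplx_scale (a * b) z.
Proof.
case: a b z => a1 a2 [b1 b2] [x y]; congr (_, _); rewrite /=.
  rewrite scalerBr scalerDr !scalerA scalerBl scalerDl !opprD !addrA.
  by rewrite addrAC; congr (_ - _); rewrite addrAC.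
rewrite scalerBr scalerDr !scalerA scalerBl scalerDl !addrA.
by rewrite addrAC; congr (_ + _); rewrite addrAC.
Qed.

Fact cplx_scale1 : left_id 1 cplx_scale.
Proof.
by case=> x y; congr (_, _); rewrite /= !scale1r !scale0r ?subr0 ?addr0.
Qed.

Fact cplx_scaleDr : right_distributive cplx_scale +%R.
Proof.
move=> a [x y] [u v]; congr (_, _); rewrite /= !scalerDr ?opprD;
by rewrite addrACA.
Qed.

Fact cplx_scaleDl z : {morph cplx_scale^~ z : a b / a + b}.
Proof.
case: z => x y [a1 a2] [b1 b2]; congr (_, _); rewrite /= !scalerDl ?opprD;
by rewrite addrACA.
Qed.

HB.instance Definition _ := GRing.Zmodule_isLmodule.Build R[i] (cplx V)
  cplx_scaleA cplx_scale1 cplx_scaleDr cplx_scaleDl.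

Lemma cplx_scaleE (c : R[i]) (z : cplx V) :
  c *: z = (complex.Re c *: z.1 - complex.Im c *: z.2, complex.Re c *: z.2 + complex.Im c *: z.1) :> cplx V.
Proof. by []. Qed.

Fact cplx_vect_iso : Vector.axiom (dim V) (cplx V).
Proof.
pose c2r (z : cplx V) : 'rV[R[i]]_(dim V) :=
  \row_j (v2r z.1 0 j +i* v2r z.2 0 j).
pose r2c (w : 'rV[R[i]]_(dim V)) : cplx V :=
  (r2v (\row_j complex.Re (w 0 j)), r2v (\row_j complex.Im (w 0 j))).
exists c2r.
  case=> c1 c2 [x y] [u v]; apply/rowP => j; rewrite !mxE /=.
  rewrite !linearD linearN !linearZ !mxE.
  by rewrite mulrN.
exists r2c => [[x y]|w].
  by congr (_, _); apply: v2r_inj; rewrite r2vK; apply/rowP => j; rewrite !mxE.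
by apply/rowP => j; rewrite !mxE /= !r2vK !mxE; case: (w 0 j).
Qed.
HB.instance Definition _ := Lmodule_hasFinDim.Build R[i] (cplx V) cplx_vect_iso.

Definition cconj (z : cplx V) : cplx V := (z.1, - z.2).

Lemma cconjK : involutive cconj.
Proof. by case=> x y; rewrite /cconj /= opprK. Qed.

Lemma cconjD : {morph cconj : x y / x + y}.
Proof. by case=> x y [u v]; congr (_, _); rewrite /= opprD. Qed.

Lemma cconjZ (c : R[i]) z : cconj (c *: z) = conjc c *: cconj z.
Proof.
case: c z => a b [x y]; rewrite !cplx_scaleE /cconj /=; congr (_, _).
  by rewrite scaleNr scalerN !opprK.
by rewrite opprD scalerN scaleNr.
Qed.

Definition conjv (L : {vspace cplx V}) : {vspace cplx V} :=
  <<map cconj (vbasis L)>>%VS.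

Lemma mem_conjv L z : (z \in conjv L) = (cconj z \in L).
Proof.
have sum_conj (n : nat) (c : 'I_n -> R[i]) (e : 'I_n -> cplx V) :
    cconj (\sum_i c i *: e i) = \sum_i conjc (c i) *: cconj (e i).
  rewrite (big_morph cconj cconjD (_ : _ = 0)).
    by apply: eq_bigr => i _; rewrite cconjZ.
  by congr (_, _); rewrite /= oppr0.
pose e := map_tuple cconj (vbasis L).
apply/idP/idP => [zL|zL].
  rewrite (coord_span (X := e) zL) sum_conj; apply: memv_suml => i _.
  apply: memvZ; rewrite (nth_map 0) ?size_tuple // cconjK.
  by apply: vbasis_mem; rewrite mem_nth ?size_tuple.
rewrite -[z]cconjK (coord_vbasis zL) sum_conj; apply: memv_suml => i _.
apply: memvZ; apply: memv_span; rewrite map_f //.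
by rewrite mem_nth ?size_tuple.
Qed.

End Complexification.

Section ComplexifiedMap.
Variables (R : realType) (V W : vectType R).

Definition cmap (f : 'Hom(V, W)) : 'Hom(cplx V, cplx W) :=
  linfun (fun z : cplx V => (f z.1, f z.2) : cplx W).

Lemma cmapE f z : cmap f z = (f z.1, f z.2).
Proof.
rewrite linfunE // => c x y; rewrite cplx_scaleE.
by congr (_, _); rewrite /= !linearD ?linearN !linearZ.
Qed.

(* The identification of V^c (+) W^c with (V (+) W)^c *)
Definition cpair (x : cplx V) (y : cplx W) : cplx (dprod V W) :=
  ((x.1, y.1), (x.2, y.2)).

End ComplexifiedMap.

Section PushForward.
Variables (R : realType) (V W : vectType R) (f : 'Hom(V, W)).

(* W^* as a subspace of V^* through f^*; this is ann (ker f), cf. mem_Wdual. *)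
Definition Wdual : {vspace dual V} := limg (transpose f).

Lemma mem_Wdual (a : dual V) :
  a \in Wdual <-> (forall x, x \in lker f -> a x = 0).
Proof.
split=> [/memv_imgP[b _ ->] x|a0].
  by rewrite memv_ker transposeE => /eqP ->; rewrite linear0.
have -> : a = transpose f (a \o f^-1)%VF.
  apply/lfunP => x; rewrite transposeE comp_lfunE; apply/eqP.
  rewrite -subr_eq0 -linearB; apply/eqP/a0.
  by rewrite memv_ker linearB /= limg_lfunVK ?subrr // memv_img ?memvf.
by rewrite memv_img ?memvf.
Qed.

Definition pull_cov : 'Hom(dprod V (dual W), big V) :=
  linfun (fun u : dprod V (dual W) => (u.1, transpose f u.2) : big V).
Definition push_vec : 'Hom(dprod V (dual W), big W) :=
  linfun (fun u : dprod V (dual W) => (f u.1, u.2) : big W).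

(* The set of (f X, eta) with (X, f^* eta) in S, cf. mem_pushforward. *)
Definition pushforward (S : {vspace cplx (big V)}) : {vspace cplx (big W)} :=
  (cmap push_vec @: (cmap pull_cov @^-1: S))%VS.

Lemma mem_pushforward S z :
  z \in pushforward S <->
  exists (X : cplx V) (eta : cplx (dual W)),
    z = cpair (cmap f X) eta /\ cpair X (cmap (transpose f) eta) \in S.
Proof.
have pullE u : pull_cov u = (u.1, transpose f u.2).
  by rewrite linfunE // => c x y; congr (_, _); rewrite /= linearP.
have pushE u : push_vec u = (f u.1, u.2).
  by rewrite linfunE // => c x y; congr (_, _); rewrite /= linearP.
split=> [/memv_imgP[[[X1 e1] [X2 e2]] uS ->]|[[X1 X2] [[e1 e2] [-> uS]]]].
  exists (X1, X2), (e1, e2); move: uS; rewrite -memv_preim.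
  by rewrite !cmapE /= !pullE !pushE.
apply/memv_imgP; exists ((X1, e1), (X2, e2)).
  by rewrite -memv_preim cmapE !pullE; move: uS; rewrite cmapE.
by rewrite !cmapE !pushE.
Qed.

Definition has_projected_structure (J : 'End(big V)) : Prop :=
  let L := passmx.leigenspace (cmap J) 'i%C in
  (pushforward L :&: pushforward (conjv L) = 0)%VS.

End PushForward.

(* Main.v *)
Require Import Defs.
From mathcomp Require Import all_boot all_order all_algebra.
From mathcomp Require Import sesquilinear reals complex.

Set Implicit Arguments.
Unset Strict Implicit.
Unset Printing Implicit Defensive.

Import GRing.Theory Num.Theory VectorInternalTheory.

Local Open Scope ring_scope.

(** Write K for ker f, seen inside V (+) V^*, and B for V (+) W^*.  Every
condition in the theorem is a rewording of the single real condition

      J K :&: B <= K                                                     (R)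

and the proof compares each of them with (R).

The projected structure ([projected_structureP]).  The push-forward only sees
the part of a subspace lying in B^c, and forgets exactly the summand K^c.  So a
common element of the push-forwards of L and of its conjugate amounts to u in L
and v in the conjugate of L, both in B^c, with k = u - v in K^c.  As u and v are
the eigencomponents of k, one has J k = i (u + v): a nonzero common element is
the same thing as some k in K^c with J k in B^c but not in K^c.  This condition
on k is the complexification of (R), since J, K and B are real.

The conditions on B ([reduction_orthov], [reduction_sub], [reduction_decomp]).
The metric is nondegenerate and K^perp = B, while J maps S^perp to (J S)^perp.
Hence perp is an order-reversing involution exchanging K with B and J K with
J B, and it turns each of the three conditions on B into (R), up to applying J
once more and to the modular law, available because K <= B.

The classical tensors ([classical_limg], [classical_flat]).  For X in ker f,
J (X, 0) = (A X, flat X), so (R) says: if X is in ker f and flat X is in W^*,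
then flat X = 0 and A X is in ker f ([classicalP]).  The first half is
W^* :&: flat (ker f) = 0.  The second half is that A preserves ker f :&: ker flat;
by double annihilation this is A^* W^* <= W^* + im flat, because ker flat = coann (im flat) when s is skew.  One may
replace im flat by flat (ker f): if X in ker f is s-orthogonal to ker f then
flat X is in W^* :&: flat (ker f), hence flat X = 0 anyway. *)

(** * Linear forms and annihilators *)

Section Annihilators.
Variables (R : realType) (V : vectType R).

(** The form is a coordinate of y - proj y, for a projection onto S: the
coordinate is chosen to be nonzero at x. *)
Lemma separating_form (S : {vspace V}) x : x \notin S ->
  exists2 a : dual V, (forall y, y \in S -> a y = 0) & a x != 0.
Proof.
move=> xS; pose g := (\1 - projv S)%VF.
have gE y : g y = y - projv S y by rewrite add_lfunE opp_lfunE id_lfunE.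
have gx0 : g x != 0.
  by apply: contraNneq xS => /eqP; rewrite gE subr_eq0 => /eqP ->; exact: memv_proj.
have /existsP[i gxi] : [exists i, v2r (g x) 0 i != 0].
  apply: contraNT gx0; rewrite negb_exists => /forallP gx0.
  apply/eqP/v2r_inj/rowP => i; rewrite linear0 mxE.
  by apply/eqP; rewrite -[_ == _]negbK gx0.
have clin : linear (fun y => v2r (g y) 0 i : R^o).
  by move=> c y z; rewrite !linearP !mxE.
exists (linfun (fun y => v2r (g y) 0 i : R^o) : dual V).
  by move=> y yS; rewrite linfunE // gE projv_id // subrr linear0 mxE.
by rewrite linfunE.
Qed.

Lemma bidual_surj (l : dual (dual V)) : exists x, forall a : dual V, l a = a x.
Proof.
have : l \in limg (bidual V) by rewrite limg_bidual memvf.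
by case/memv_imgP=> x _ ->; exists x => a; rewrite bidualE.
Qed.

End Annihilators.

(** Half of the double annihilator theorem, the half that needs finite
dimension: a form on V^* separating a from S is evaluation at a vector. *)
Lemma coannP (R : realType) (V : vectType R) (S : {vspace dual V}) (a : dual V) :
  (forall x, x \in coann S -> a x = 0) -> a \in S.
Proof.
move=> aS; apply: contraT => /separating_form[l lS].
have [x lE] := bidual_surj l; rewrite lE aS ?eqxx //.
by apply/mem_coann => b bS; rewrite -lE lS.
Qed.

(** * The neutral metric *)

Section Metric.
Variables (R : realType) (V : vectType R).
Implicit Types (S T : {vspace big V}) (x y : big V).
Local Notation perp := (orthov (@metric R V)).

Lemma metricC x y : metric x y = metric y x.
Proof. by rewrite /metric addrC. Qed.

Lemma metric_embV x v : metric x (embV v) = 2^-1 * x.2 v.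
Proof. by rewrite /metric embVE /= zero_lfunE addr0. Qed.

(** Riesz representation.  The factors 2 cancel the 1/2 in the metric. *)
Lemma metric_repr (l : dual (big V)) : exists y, forall x, l x = metric x y.
Proof.
have [Y lY] := bidual_surj (l \o embD)%VF.
exists (2 *: Y, 2 *: (l \o embV)%VF) => -[X a].
have -> : (X, a) = embV X + embD a :> big V.
  by rewrite embVE embDE; congr (_, _); rewrite /= ?addr0 ?add0r.
rewrite linearD /= -[l (embD a)]comp_lfunE lY.
rewrite /metric embVE embDE /= addr0 add0r linearZ scale_lfunE comp_lfunE /=.
rewrite embVE -![_ *: _]/(2 * _) -mulrDr mulrA mulVf ?mul1r ?pnatr_eq0 //.
by rewrite addrC.
Qed.

(** The metric is nondegenerate: a form separating x from S is the metric
product with a vector of the orthogonal of S. *)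
Lemma metric_orthovK : involutive perp.
Proof.
move=> S; apply/vspaceP => x; apply/idP/idP => [|xS]; last first.
  by apply/mem_orthovP => y /mem_orthovP/(_ x xS) <-; exact: metricC.
move=> /mem_orthovP xS; apply: contraT => /separating_form[l lS].
have [y lE] := metric_repr l; rewrite lE xS ?eqxx //.
by apply/mem_orthovP => z zS; rewrite -(lS z zS) lE; exact: metricC.
Qed.

End Metric.

(** * Orthogonality and a skew complex structure *)

Section ComplexStructure.
Variables (F : fieldType) (U : vectType F) (J : 'End(U)).
Hypothesis JK : forall x, J (J x) = - x.
Implicit Types (S T : {vspace U}).

Lemma mem_limg_complex S x : (x \in (J @: S)%VS) = (J x \in S).
Proof.
apply/memv_imgP/idP => [[y yS ->]|JxS]; first by rewrite JK memvN.
by exists (- J x); rewrite ?memvN // linearN /= JK opprK.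
Qed.

Lemma limg_complexK S : (J @: (J @: S) = S)%VS.
Proof. by apply/vspaceP=> x; rewrite !mem_limg_complex JK memvN. Qed.

Lemma limg_complexI S T : (J @: (S :&: T) = J @: S :&: J @: T)%VS.
Proof. by apply/vspaceP=> x; rewrite !(mem_limg_complex, memv_cap). Qed.

Lemma limg_complexS S T : (J @: S <= J @: T)%VS = (S <= T)%VS.
Proof. by apply/idP/idP => /(limgS J); rewrite ?limg_complexK. Qed.

Variable form : {symmetric U}.
Hypothesis Jskew : forall x y, form x (J y) + form (J x) y = 0.

(** A skew J with J^2 = -1 is an isometry. *)
Lemma orthov_complex S : orthov form (J @: S) = (J @: orthov form S)%VS.
Proof.
apply/vspaceP => x; rewrite mem_limg_complex.
apply/mem_orthovP/mem_orthovP => xS y yS.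
  by have := Jskew x y; rewrite (xS (J y)) ?memv_img // add0r.
have := Jskew x (J y); rewrite JK linearNr (xS (J y)) -?mem_limg_complex //.
by rewrite addr0 => /eqP; rewrite oppr_eq0 => /eqP.
Qed.

Hypothesis orthovK : involutive (orthov form).

Lemma orthovS S T : (orthov form S <= orthov form T)%VS = (T <= S)%VS.
Proof. by rewrite orthov_sym orthovK. Qed.

Lemma orthov_add S T : orthov form (S + T) = (orthov form S :&: orthov form T)%VS.
Proof.
apply/eqP; rewrite eqEsubv; apply/andP; split.
  by rewrite subv_cap !orthovS addvSl addvSr.
by rewrite orthov_sym orthoDv ![(_ <= orthov _ (_ :&: _))%VS]orthov_sym capvSl capvSr.
Qed.

Lemma orthov_cap S T : orthov form (S :&: T) = (orthov form S + orthov form T)%VS.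
Proof. by apply: (can_inj orthovK); rewrite orthov_add !orthovK. Qed.

Variables (K B : {vspace U}).
Hypotheses (KB : (K <= B)%VS) (orthK : orthov form K = B).

Let orthB : orthov form B = K. Proof. by rewrite -orthK orthovK. Qed.

(** The orthogonal of J B is J K because that of B is K. *)
Lemma reduction_orthov :
  (orthov form (J @: B) :&: B <= K)%VS = (J @: K :&: B <= K)%VS.
Proof. by rewrite orthov_complex orthB. Qed.

(** The orthogonal of the left-hand side reads K :&: J B <= J K; applying J
gives the right-hand side. *)
Lemma reduction_sub : (J @: B <= B + J @: K)%VS = (J @: K :&: B <= K)%VS.
Proof.
rewrite -orthovS orthov_add !orthov_complex orthK orthB.
by rewrite -limg_complexS limg_complexI !limg_complexK capvC.
Qed.

(** The orthogonal of the left-hand side reads K = (K + J K) :&: B, which is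
K = K + (J K :&: B) by the modular law. *)
Lemma reduction_decomp :
  (B == B :&: J @: B + K)%VS = (J @: K :&: B <= K)%VS.
Proof.
rewrite -(inj_eq (can_inj orthovK)) orthov_add orthov_cap.
rewrite orthov_complex orthB orthK -vspace_modl // eq_sym.
by apply/eqP/idP => [/addv_idPl|] //; move/addv_idPl.
Qed.

End ComplexStructure.

Lemma gen_complexK (R : realType) (V : vectType R) (J : 'End(big V)) :
  gen_complex J -> forall x, J (J x) = - x.
Proof. by case=> JJ _ x; rewrite -comp_lfunE JJ opp_lfunE id_lfunE. Qed.

(** * The subspaces ker f and V (+) W^* *)

Section Projection.
Variables (R : realType) (V W : vectType R) (f : 'Hom(V, W)).
Hypothesis fsurj : limg f = fullv.

Lemma transpose_inj : injective (transpose f).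
Proof.
move=> a b ab; apply/lfunP => w.
have /memv_imgP[x _ ->] : w \in limg f by rewrite fsurj memvf.
by rewrite -!transposeE ab.
Qed.

Lemma mem_embV (S : {vspace V}) (x : big V) :
  (x \in (embV @: S)%VS) = (x.1 \in S) && (x.2 == 0).
Proof.
apply/memv_imgP/andP => [[y yS ->]|[x1S /eqP x20]].
  by rewrite embVE eqxx.
by exists x.1 => //; rewrite embVE -x20; case: (x).
Qed.

Lemma mem_coisotropic (x : big V) :
  (x \in dsum fullv (Wdual f)) = (x.2 \in Wdual f).
Proof. by rewrite mem_dsum memvf. Qed.

Lemma embV_sub_coisotropic : (embV @: lker f <= dsum fullv (Wdual f))%VS.
Proof.
apply/subvP => x; rewrite mem_embV mem_coisotropic => /andP[_ /eqP ->].
exact: mem0v.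
Qed.

Lemma orthov_lker :
  orthov metric (embV @: lker f) = dsum fullv (Wdual f).
Proof.
apply/vspaceP => x; rewrite mem_coisotropic.
apply/mem_orthovP/idP => [xK|/mem_Wdual xK y].
  apply/mem_Wdual => y yK.
  have /xK : embV y \in (embV @: lker f)%VS by exact: memv_img.
  rewrite -[LHS]/(metric x (embV y)) metric_embV => /eqP.
  by rewrite mulf_eq0 invr_eq0 pnatr_eq0 => /eqP.
case/memv_imgP=> k kK ->; rewrite -[LHS]/(metric x (embV k)) metric_embV.
by rewrite xK // mulr0.
Qed.

End Projection.

(** * Projected structure as a real condition *)

Section Eigenspace.
Variables (R : realType) (U : vectType R) (J : 'End(U)).

Lemma mem_leigenspace_i (z : cplx U) :
  (z \in passmx.leigenspace (cmap J) 'i%C) = (J z.1 == - z.2) && (J z.2 == z.1).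
Proof.
rewrite memv_ker add_lfunE opp_lfunE scale_lfunE id_lfunE subr_eq0 cmapE.
by rewrite cplx_scaleE /= !scale0r !scale1r sub0r add0r.
Qed.

Lemma mem_conjv_leigenspace_i (z : cplx U) :
  (z \in conjv (passmx.leigenspace (cmap J) 'i%C)) =
    (J z.1 == z.2) && (J z.2 == - z.1).
Proof.
by rewrite mem_conjv mem_leigenspace_i /= opprK linearN eqr_oppLR.
Qed.

End Eigenspace.

Section Projected.
Variables (R : realType) (V W : vectType R) (J : 'End(big V)) (f : 'Hom(V, W)).
Hypotheses (Jgc : gen_complex J) (fsurj : limg f = fullv).
Let K := (embV @: lker f)%VS.
Let B := dsum fullv (Wdual f).

(** A common element of the two push-forwards comes from u in L and v in the
conjugate of L with u - v in K^c and J (u - v) = i (u + v); conversely k in K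
with J k in B splits, up to a factor 2, as such a difference u - v. *)
Lemma projected_structureP :
  has_projected_structure f J <-> (J @: K :&: B <= K)%VS.
Proof.
split=> [proj|JKB].
  apply/subvP => x; rewrite memv_cap mem_coisotropic => /andP[/memv_imgP[k kK ->]].
  case Jk : (J k) => [Y b] /= /memv_imgP[eta _ bE].
  set L := passmx.leigenspace (cmap J) 'i%C.
  (* Twice the L-component of k is u = k - i J k = (k, - J k) as a pair, and v
     is - (k + i J k) = (- k, - J k); both push forward to z, since f kills k. *)
  pose z : cplx (big W) := cpair (0, - f Y) (0, - eta).
  have : z \in (pushforward f L :&: pushforward f (conjv L))%VS.
    move: kK; rewrite mem_embV memv_ker => /andP[/eqP fk /eqP k2].
    have kE : k = (k.1, 0) by rewrite -k2; case: (k).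
    rewrite memv_cap; apply/andP; split; apply/mem_pushforward.
      exists (k.1, - Y), (0, - eta); split.
        by rewrite cmapE /= fk linearN.
      rewrite cmapE /= linear0 linearN /= -bE mem_leigenspace_i /= -kE.
      have -> : (- Y, - b) = - J k :> big V by rewrite Jk.
      by rewrite opprK linearN /= gen_complexK // opprK !eqxx.
    exists (- k.1, - Y), (0, - eta); split.
      by rewrite cmapE /= !linearN /= fk oppr0.
    rewrite cmapE /= linear0 linearN /= -bE mem_conjv_leigenspace_i /=.
    have -> : (- k.1, 0) = - k :> big V by rewrite [in RHS]kE -[RHS]/(- k.1, - 0) oppr0.
    have -> : (- Y, - b) = - J k :> big V by rewrite Jk.
    by rewrite !linearN /= gen_complexK // opprK !eqxx.
  have -> : (pushforward f L :&: pushforward f (conjv L) = 0)%VS by exact: proj.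
  rewrite memv0 => /eqP[/eqP fY /eqP eta0].
  rewrite mem_embV memv_ker /= bE; move: fY eta0; rewrite !oppr_eq0 => -> /eqP ->.
  by rewrite linear0 eqxx.
rewrite /has_projected_structure /=.
apply/eqP; rewrite -subv0; apply/subvP => z; rewrite memv_cap memv0.
case/andP=> /mem_pushforward[[X1 X2] [[e1 e2] [zE]]].
rewrite mem_leigenspace_i !cmapE /= => /andP[/eqP Ju1 /eqP Ju2].
case/mem_pushforward=> [[Y1 Y2] [[d1 d2] []]].
rewrite zE !cmapE /cpair /= => -[fX1 <- fX2 <-].
rewrite mem_conjv_leigenspace_i /= => /andP[/eqP Jv1 /eqP Jv2].
(* With u = u1 + i u2 and v = v1 + i v2, the vectors u1 - v1 and u2 - v2 are in
   K and are mapped by J to - (u2 + v2) and u1 + v1, which are in B. *)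
have key (X Y Z : V) (e : dual W) : f X = f Y ->
    J (X - Y, 0) = (Z, transpose f e) -> f Z = 0 /\ e = 0.
  move=> fXY Jk; have /(subvP JKB) : (Z, transpose f e) \in (J @: K :&: B)%VS.
    rewrite memv_cap mem_coisotropic /= memv_img ?memvf // andbT -Jk memv_img //.
    by rewrite mem_embV memv_ker /= linearB /= fXY subrr !eqxx.
  rewrite mem_embV memv_ker => /andP[/eqP fZ /eqP /= te0]; split=> //.
  by apply: (transpose_inj fsurj); rewrite linear0; exact: te0.
have half (U : vectType R) (u : U) : u + u = 0 -> u = 0.
  by move=> /eqP; rewrite -mulr2n -scaler_nat scaler_eq0 pnatr_eq0 => /eqP.
have diff (X Y : V) (a : dual V) : J (X - Y, 0) = J (X, a) - J (Y, a).
  by rewrite -linearB; congr (J _); congr (_, _); rewrite /= subrr.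
have [] := key X1 Y1 (- (X2 + Y2)) (- (e2 + e2)) fX1.
  rewrite (diff _ _ (transpose f e1)) Ju1 Jv1 -opprD; congr (- _, _).
  by rewrite [RHS]linearN [in RHS]linearD.
rewrite linearN linearD /= -fX2 => /eqP; rewrite oppr_eq0 => /eqP/half -> .
move/eqP; rewrite oppr_eq0 => /eqP/half ->.
have [] := key X2 Y2 (X1 + Y1) (e1 + e1) fX2.
  rewrite (diff _ _ (transpose f e2)) Ju2 Jv2 opprK; congr (_, _).
  by rewrite /= linearD.
by rewrite linearD /= -fX1 => /half -> /half ->.
Qed.

End Projected.

(** * The condition in terms of the classical tensors *)

Section Classical.
Variables (R : realType) (V W : vectType R) (J : 'End(big V)).
Variables (A : 'End(V)) (p : {skew_symmetric dual V}) (s : {skew_symmetric V}).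
Variable f : 'Hom(V, W).
Hypothesis Jcl : classical_tensors J A p s.
Let K := lker f.
Let P := (J @: (embV @: K) :&: dsum fullv (Wdual f) <= embV @: K)%VS.

Lemma flat_skew x y : flat s x y = - flat s y x.
Proof. by rewrite !flatE hermC expr1 mulN1r. Qed.

(** The condition (R), tested on J (x, 0) = (A x, flat x) with x in ker f. *)
Lemma classicalP : P <-> forall x, x \in K -> flat s x \in Wdual f ->
  A x \in K /\ flat s x = 0.
Proof.
have JE x : J (embV x) = (A x, flat s x).
  by rewrite embVE Jcl (linear0 (sharp p)) addr0 (linear0 (transpose A)) [_ - 0]subr0.
split=> [/subvP PP x xK xW|PP].
  have := PP (J (embV x)); rewrite memv_cap mem_coisotropic JE /= xW -JE !memv_img //.
  by rewrite JE mem_embV => /(_ isT)/andP[? /eqP ?].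
apply/subvP => y; rewrite memv_cap mem_coisotropic.
move=> /andP[/memv_imgP[_ /memv_imgP[x xK ->] ->]]; rewrite JE /= => /(PP x xK)[AxK x0].
by rewrite mem_embV /= AxK x0 eqxx.
Qed.

(** The inclusion dual to A (coann S) <= ker f, ker f being coann (Wdual f). *)
Lemma transpose_Wdual_sub (S : {vspace dual V}) :
  (transpose A @: Wdual f <= S)%VS <->
  (forall x, x \in coann S -> A x \in K).
Proof.
split=> [AS x /mem_coann xS | AK].
  apply: contraT => /separating_form[a /mem_Wdual aW].
  by rewrite -transposeE xS ?eqxx // (subvP AS) // memv_img.
apply/subvP => _ /memv_imgP[a /mem_Wdual aW ->]; apply: coannP => x xS.
by rewrite transposeE aW // AK.
Qed.

Lemma mem_coann_Wdual_add (S : {vspace dual V}) x :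
  x \in coann (Wdual f + S) <-> x \in K /\ x \in coann S.
Proof.
split=> [/mem_coann xWS | [xK /mem_coann xS]].
  split; last by apply/mem_coann => a aS; apply: xWS; apply: (subvP (addvSr _ _)).
  apply: contraT => /separating_form[a /mem_Wdual aW].
  by rewrite xWS ?eqxx //; apply: (subvP (addvSl _ _)).
apply/mem_coann => _ /memv_addP[a /mem_Wdual aW [b bS ->]].
by rewrite add_lfunE aW // xS // addr0.
Qed.

Lemma mem_coann_flat (U : {vspace V}) x :
  x \in coann (flat s @: U) <-> (forall y, y \in U -> flat s x y = 0).
Proof.
split=> [/mem_coann xU y yU | xU].
  by rewrite flat_skew xU ?oppr0 // memv_img.
by apply/mem_coann => _ /memv_imgP[y yU ->]; rewrite flat_skew xU // oppr0.
Qed.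

Lemma flat_cap0P : (Wdual f :&: flat s @: K = 0)%VS <->
  (forall x, x \in K -> flat s x \in Wdual f -> flat s x = 0).
Proof.
split=> [WK0 x xK xW|H].
  by apply/eqP; rewrite -memv0 -WK0 memv_cap xW memv_img.
apply/eqP; rewrite -subv0; apply/subvP => a; rewrite memv_cap memv0.
by case/andP=> + /memv_imgP[x xK aE]; rewrite aE => /(H x xK) ->.
Qed.

(** Here coann (Wdual f + limg (flat s)) is the intersection of ker f and
ker (flat s), where the condition of [classicalP] makes A x lie in ker f. *)
Lemma classical_limg : P <-> (Wdual f :&: flat s @: K = 0)%VS /\
  (transpose A @: Wdual f <= Wdual f + limg (flat s))%VS.
Proof.
rewrite classicalP flat_cap0P transpose_Wdual_sub.
split=> [H|[H1 H2] x xK xW]; last first.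
  have x0 := H1 x xK xW; split=> //; apply: H2; apply/mem_coann_Wdual_add.
  by split=> //; apply/mem_coann_flat => y _; rewrite x0 zero_lfunE.
split=> [x xK xW|x /mem_coann_Wdual_add[xK /mem_coann_flat x0]].
  by case: (H x xK xW).
have {}x0 : flat s x = 0 by apply/lfunP => y; rewrite x0 ?memvf // zero_lfunE.
by case: (H x xK); rewrite // x0 mem0v.
Qed.

(** Here coann (Wdual f + flat s @: K) consists of the x in ker f that are
s-orthogonal to ker f, i.e. with flat s x in Wdual f: exactly the vectors that
[classicalP] is about. *)
Lemma classical_flat : P <-> (Wdual f :&: flat s @: K = 0)%VS /\
  (transpose A @: Wdual f <= Wdual f + flat s @: K)%VS.
Proof.
rewrite classicalP flat_cap0P transpose_Wdual_sub.
split=> [H|[H1 H2] x xK xW]; last first.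
  have x0 := H1 x xK xW; split=> //; apply: H2; apply/mem_coann_Wdual_add.
  by split=> //; apply/mem_coann_flat => y _; rewrite x0 zero_lfunE.
split=> [x xK xW|x /mem_coann_Wdual_add[xK /mem_coann_flat x0]].
  by case: (H x xK xW).
have xW : flat s x \in Wdual f by apply/mem_Wdual.
by case: (H x xK xW).
Qed.

(** The intersection on the right is the annihilator of the sum on the left,
since W^* = ann (ker f) and flat (ker f) = ann (coann (flat (ker f))). *)
Lemma lker_coann_full :
  fullv = (K + coann (flat s @: K))%VS <-> (Wdual f :&: flat s @: K = 0)%VS.
Proof.
rewrite flat_cap0P; split=> [VE x xK /mem_Wdual xW|H].
  apply/lfunP => y; rewrite zero_lfunE; have := memvf y; rewrite VE.
  case/memv_addP=> u uK [v /mem_coann_flat vK ->].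
  by rewrite linearD /= xW // flat_skew vK // oppr0 addr0.
apply/eqP; rewrite eqEsubv subvf andbT; apply/subvP => y _.
apply: contraT => /separating_form[a aS].
have : a \in (flat s @: K)%VS.
  by apply: coannP => x xS; apply: aS; apply: (subvP (addvSr _ _)).
case/memv_imgP=> x xK aE; move: aS; rewrite aE => aS.
rewrite H ?zero_lfunE ?eqxx //; apply/mem_Wdual => k kK.
by apply: aS; apply: (subvP (addvSl _ _)).
Qed.

End Classical.

Theorem proposition3p3 (R : realType) (V W : vectType R) (J : 'End(big V))
    (A : 'End(V)) (p : {skew_symmetric dual V}) (s : {skew_symmetric V})
    (f : 'Hom(V, W)) :
  gen_complex J -> classical_tensors J A p s -> limg f = fullv ->
  let K := lker f in
  let B := dsum fullv (Wdual f) in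
  [/\ (has_projected_structure f J <->
        (Wdual f :&: flat s @: K = 0)%VS /\
        (transpose A @: Wdual f <= Wdual f + limg (flat s))%VS),
      (has_projected_structure f J <->
        [/\ fullv = (K + coann (flat s @: K))%VS,
            directv (Wdual f + flat s @: K) &
            (transpose A @: Wdual f <= Wdual f + flat s @: K)%VS]),
      (has_projected_structure f J <->
        B = (B :&: J @: B + embV @: K)%VS),
      (has_projected_structure f J <->
        (J @: B <= B + J @: (embV @: K))%VS) &
      (has_projected_structure f J <->
        (orthov metric (J @: B) :&: B <= embV @: K)%VS)].
Proof.
move=> Jgc Jcl fsurj K B; have JK := gen_complexK Jgc.
have Jskew : forall x y, metric x (J y) + metric (J x) y = 0 by case: Jgc.
have orthK := @metric_orthovK R V.
have KB := embV_sub_coisotropic f.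
have KperpE := orthov_lker f.
have projE := projected_structureP Jgc fsurj.
split; rewrite projE.
- exact: classical_limg Jcl.
- rewrite (classical_flat f Jcl); split=> [[W0 AW]|[_ /directv_addP]] //.
  by split=> //; [apply/lker_coann_full | apply/directv_addP].
- rewrite -(reduction_decomp JK Jskew orthK KB KperpE).
  by split=> /eqP.
- by rewrite -(reduction_sub JK Jskew orthK KperpE).
- by rewrite -(reduction_orthov JK Jskew orthK KperpE).
Qed.
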